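(* The map $\theta:\mathbb{L}\to\mathbb{W}(\mathbb{L})$ defined by \[ \theta(r)(m_{\lambda})= \begin{cases} nr & \text{if } \lambda=(n)\text{ for some } n\in\mathbb{N}_{>0},\\ \infty & \text{otherwise} \end{cases} \qquad(r\in\mathbb{L},\ \lambda\in\mathbb{P}) \] is a (well-defined) monoidal functor from the monoidal poset $\mathbb{L}$ to the monoidal poset $\mathbb{W}(\mathbb{L})$.
   Context: A rig is a semiring with $0$ and $1$ (negatives not required); rig homomorphisms preserve $0,1,+,\cdot$. $\mathbb{N}$ contains $0$, and $\mathbb{N}_{>0}=\mathbb{N}\setminus\{0\}$. The Lawvere quantale $\mathbb{L}$: the underlying set is $[0,\infty]$ with order $x\leq_{\mathbb{L}}y$ if and only if $y\leq x$ in the usual order. As a commutative rig, $\mathbb{L}$ has addition $x\oplus_{\mathbb{L}}y=\min\{x,y\}$ (zero element $\infty$) and multiplication $x\otimes_{\mathbb{L}}y=x+y$ (unit $0$). It is also a monoidal poset with order $\leq_{\mathbb{L}}$, product $\otimes_{\mathbb{L}}$ and unit $0$. Here $nr$ is the usual product, with $n\cdot\infty=\infty$. $\Lambda$ is the commutative rig of symmetric functions in countably many variables $x_1,x_2,\dots$ with coefficients in $\mathbb{N}$ (of bounded degree). $\mathbb{P}$ is the set of all partitions of all $n\in\mathbb{N}_{>0}$. For $\lambda\in\mathbb{P}$, $m_\lambda$ is the monomial symmetric function; the $m_\lambda$ ($\lambda\in\mathbb{P}$) together with $1$ form an $\mathbb{N}$-basis of $\Lambda$, so a rig homomorphism $f:\Lambda\to\mathbb{L}$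 (which has $f(1)=0$ and $f(0)=\infty$) is determined by its values $f(m_\lambda)$, $\lambda\in\mathbb{P}$. $(n)$ denotes the one-part partition of $n$. The co-multiplication is the rig homomorphism $\Delta^{\times}:\Lambda\to\Lambda\otimes_{\mathbb{N}}\Lambda$, $\Delta^{\times}(f(x_1,x_2,\dots))=f(x_1\otimes x_1,x_1\otimes x_2,\dots,x_i\otimes x_j,\dots)$. $\mathbb{W}(\mathbb{L})$ is the set of rig homomorphisms $\Lambda\to\mathbb{L}$. It is a monoidal poset with: order $f\leq_{\mathbb{W}(\mathbb{L})}g$ if and only if $f(m_\lambda)\leq_{\mathbb{L}}g(m_\lambda)$ for all $\lambda\in\mathbb{P}$; product $f\otimes_{\mathbb{W}(\mathbb{L})}g$ given by $\Delta^{\times}$ followed by $f\otimes g$ and the multiplication of $\mathbb{L}$, explicitly $(f\otimes_{\mathbb{W}(\mathbb{L})}g)(m_\lambda)=\min_{\mu,\mu'}\{f(m_\mu)+g(m_{\mu'})\}$ over the pairs $(\mu,\mu')$ with nonzero coefficient in the unique expression $\Delta^{\times}(m_\lambda)=\sum c^{\lambda}_{\mu,\mu'}m_\mu\otimes m_{\mu'}$, $c^{\lambda}_{\mu,\mu'}\in\mathbb{N}$; unit $\overline{0}$, the rig homomorphism with $\overline{0}(m_{(n)})=0$ for all $n\in\mathbb{N}_{>0}$ and $\overline{0}(m_\lambda)=\infty$ for all other $\lambda\in\mathbb{P}$. A monoidal functor between monoidal posets is an order-preserving map $F$ with $F(a\otimes b)=F(a)\otimes F(b)$ and $F(\text{unit})=\text{unit}$.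 *)

(* Defs.v *)
From HB Require Import structures.
From mathcomp Require Import all_boot all_order all_algebra finmap multiset.
From mathcomp Require Import all_classical all_reals ereal.
From Stdlib Require Import Cantor.

Set Implicit Arguments.
Unset Strict Implicit.
Unset Printing Implicit Defensive.

Import Order.TTheory GRing.Theory Num.Theory.

Local Open Scope classical_set_scope.
Local Open Scope mset_scope.
Local Open Scope nat_scope.

(* A monomial in the variables x_i (i : I) is a finite multiset of variables:
   [A i] is the exponent of x_i, [`+`] is multiplication and [size A] is the
   degree. [msetmap f] is the substitution x_i := x_(f i). *)
Definition msetmap (I J : choiceType) (f : I -> J) (A : {mset I}) : {mset J} :=
  seq_mset [seq f i | i <- A].

Section Msetmap.

Lemma seq_mset_cat (I : choiceType) (s t : seq I) :
  seq_mset (s ++ t) = seq_mset s `+` seq_mset t.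
Proof. by apply/msetP => i; rewrite msetE2 !mset_seqE count_cat. Qed.

Lemma seq_mset0 (I : choiceType) : seq_mset [::] = mset0 :> {mset I}.
Proof. by apply/msetP => i; rewrite mset_seqE mset0E. Qed.

Lemma msetmap_seq (I J : choiceType) (f : I -> J) (s : seq I) :
  msetmap f (seq_mset s) = seq_mset (map f s).
Proof. by apply/eq_seq_msetP/perm_map/perm_eq_seq_mset. Qed.

Lemma msetmap0 (I J : choiceType) (f : I -> J) : msetmap f mset0 = mset0.
Proof. by rewrite -seq_mset0 msetmap_seq seq_mset0. Qed.

Lemma msetmapD (I J : choiceType) (f : I -> J) (A B : {mset I}) :
  msetmap f (A `+` B) = msetmap f A `+` msetmap f B.
Proof.
rewrite -[A]seq_mset_id -[B]seq_mset_id -seq_mset_cat !msetmap_seq.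
by rewrite map_cat seq_mset_cat.
Qed.

Lemma msetmap_comp (I J K : choiceType) (g : J -> K) (f : I -> J)
    (A : {mset I}) : msetmap g (msetmap f A) = msetmap (g \o f) A.
Proof. by rewrite -[A]seq_mset_id !msetmap_seq map_comp. Qed.

Lemma eq_msetmap (I J : choiceType) (f g : I -> J) (A : {mset I}) :
  f =1 g -> msetmap f A = msetmap g A.
Proof. by move=> fg; rewrite /msetmap (eq_map fg). Qed.

Lemma msetmap_id (I : choiceType) (A : {mset I}) : msetmap id A = A.
Proof. by rewrite /msetmap map_id seq_mset_id. Qed.

Lemma msetmapK (I J : choiceType) (f : I -> J) (g : J -> I) :
  cancel f g -> cancel (msetmap f) (msetmap g).
Proof.
by move=> fK A; rewrite msetmap_comp (@eq_msetmap _ _ _ id) ?msetmap_id.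
Qed.

Lemma size_seq_mset (I : choiceType) (s : seq I) : size (seq_mset s) = size s.
Proof. exact/perm_size/perm_eq_seq_mset. Qed.

Lemma size_msetmap (I J : choiceType) (f : I -> J) (A : {mset I}) :
  size (msetmap f A) = size A.
Proof. by rewrite size_seq_mset size_map. Qed.

Lemma size_msetD (I : choiceType) (A B : {mset I}) :
  size (A `+` B) = size A + size B.
Proof.
by rewrite -[A]seq_mset_id -[B]seq_mset_id -seq_mset_cat !size_seq_mset size_cat.
Qed.

Lemma mem_msetmap (I J : choiceType) (f : I -> J) (A : {mset I}) i :
  i \in A -> f i \in msetmap f A.
Proof.
by move=> iA; rewrite /msetmap (perm_mem (perm_eq_seq_mset _)) map_f.
Qed.

Lemma msetmap_app (I J : choiceType) (f : I -> J) (A : {mset I}) i :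
  injective f -> msetmap f A (f i) = A i.
Proof.
move=> fI; rewrite mset_seqE count_map -count_mem_mset.
by apply: eq_count => j /=; rewrite (inj_eq fI).
Qed.

Lemma finite_mset (I : choiceType) (s : seq I) n :
  finite_set [set A : {mset I} | size A <= n /\ {subset A <= s}].
Proof.
elim: n => [|n IHn].
  apply: (@sub_finite_set _ _ [set mset0]); last exact: finite_set1.
  by move=> A [] /=; rewrite leqn0 size_mset_eq0 => /eqP ->.
apply: (@sub_finite_set _ _ ([set mset0] `|` [set a +` B | a in [set` s]
   & B in [set A : {mset I} | size A <= n /\ {subset A <= s}]])); last first.
  rewrite finite_setU; split; first exact: finite_set1.
  exact: finite_image2.
move=> A [szA As]; case: (mset_0Vmem A) => [->|[a aA]]; [by left|right].
exists a; first exact: As.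
exists (A `\ a); last exact: msetB1K.
split; last by move=> b; rewrite in_msetB1 => /andP[_ /As].
by move: szA; rewrite -{1}(msetB1K aA) size_msetD enum_msetn.
Qed.

Lemma finite_msubset (I : choiceType) (A : {mset I}) :
  finite_set [set B : {mset I} | B `<=` A]%mset.
Proof.
apply: sub_finite_set (finite_mset A (size A)) => B /= BA.
split; last exact: msubset_subset.
by rewrite -(msetBDKC BA) size_msetD leq_addr.
Qed.

Lemma finite_splits (I : choiceType) (A : {mset I}) :
  finite_set [set p : {mset I} * {mset I} | p.1 `+` p.2 = A].
Proof.
apply: sub_finite_set (finite_setX (finite_msubset A) (finite_msubset A)).
move=> [B C] /= BCA; split; apply/msubsetP => i; rewrite -BCA msetE2 /=.
  exact: leq_addr.
exact: leq_addl.
Qed.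

Lemma finite_margins (I J : choiceType) (B : {mset I}) (C : {mset J}) :
  finite_set [set A : {mset I * J} | msetmap fst A = B /\ msetmap snd A = C].
Proof.
pose s := [seq (i, j) | i <- (B : seq I), j <- (C : seq J)].
apply: sub_finite_set (finite_mset s (size B)) => A [AB AC] /=; split.
  by rewrite -AB size_msetmap.
move=> [i j] ijA; apply/allpairsP; exists (i, j) => /=; split => //.
  by rewrite -AB (mem_msetmap fst ijA).
by rewrite -AC (mem_msetmap snd ijA).
Qed.

End Msetmap.
(* A formal power series in x_0, x_1, ... (indexed from 0) over nat is given by
   its coefficients; it lies in Lambda when it is invariant under all
   permutations of the variables and has bounded degree. *)
Definition series := {mset nat} -> nat.

Definition symmetric_series (c : series) : Prop :=
  forall s : nat -> nat, bijective s ->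
  forall A : {mset nat}, c (msetmap s A) = c A.

Definition bounded_degree (c : series) : Prop :=
  exists d : nat, forall A : {mset nat}, c A != 0 -> size A <= d.

Record symfun := Symfun {
  coef :> {mset nat} -> nat;
  coef_sym : symmetric_series coef;
  coef_bounded : bounded_degree coef }.

Lemma symfunP (f g : symfun) : coef f =1 coef g -> f = g.
Proof.
case: f g => [f fs fb] [g gs gb] /= /funext fg; subst g.
by rewrite (Prop_irrelevance fs gs) (Prop_irrelevance fb gb).
Qed.

HB.instance Definition _ := gen_eqMixin symfun.
HB.instance Definition _ := gen_choiceMixin symfun.

Definition series0 : series := fun=> 0.
Definition series1 : series := fun A => (A == mset0).
Definition series_add (c d : series) : series := fun A => c A + d A.
Definition series_mul (c d : series) : series := fun A =>
  \big[addn/0]_(p \in [set p : {mset nat} * {mset nat} | p.1 `+` p.2 = A])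
    (c p.1 * d p.2).

Section SeriesTheory.
Implicit Types (c d e : series) (A B C : {mset nat}).

Lemma series_mulE c d (D : seq {mset nat}) A :
  uniq D -> (forall B, (B `<=` A)%mset -> B \in D) ->
  series_mul c d A = \sum_(B <- D) \sum_(C <- D | B `+` C == A) c B * d C.
Proof.
move=> uD DA; pose r := [seq (B, C) | B <- D, C <- D].
have ur : uniq r by apply: allpairs_uniq => // -[? ?] [? ?].
rewrite /series_mul (fsbigE [seq p <- r | p.1 `+` p.2 == A]).
- rewrite big_filter_cond (eq_bigl (fun p => p.1 `+` p.2 == A)); last first.
    by move=> p; case: eqP => //= e; exact: mem_set.
  rewrite big_mkcond /r big_allpairs; apply: eq_bigr => B _.
  by rewrite [RHS]big_mkcond.
- exact: filter_uniq.
- by move=> p /=; rewrite mem_filter => /andP[/eqP].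
move=> [B C] /= e; rewrite mem_filter e eqxx /= => /negP[].
apply/allpairsP; exists (B, C); split => //=; apply: DA; apply/msubsetP => i.
  by rewrite -e msetE2 leq_addr.
by rewrite -e msetE2 leq_addl.
Qed.

Definition msubs A : seq {mset nat} := fset_set [set B | (B `<=` A)%mset].

Lemma msubs_uniq A : uniq (msubs A).
Proof. exact: fset_uniq. Qed.

Lemma mem_msubs A B : (B \in msubs A) = (B `<=` A)%mset.
Proof.
rewrite /msubs in_fset_set; last exact: finite_msubset.
by apply/idP/idP; rewrite inE.
Qed.

Lemma series_mul_neq0 c d A : series_mul c d A != 0 <->
  exists B C, [/\ A = B `+` C, c B != 0 & d C != 0].
Proof.
rewrite (@series_mulE c d (msubs A)) ?msubs_uniq//; last first.
  by move=> B; rewrite mem_msubs.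
split.
  rewrite sum_nat_seq_neq0 => /hasP[B _] /=.
  rewrite sum_nat_seq_neq0 => /hasP[C _] /andP[/eqP <-].
  by rewrite muln_eq0 negb_or => /andP[cB dC]; exists B, C.
move=> [B [C [-> cB dC]]]; rewrite sum_nat_seq_neq0; apply/hasP; exists B.
  by rewrite mem_msubs; apply/msubsetP => i; rewrite msetE2 leq_addr.
rewrite /= sum_nat_seq_neq0; apply/hasP; exists C.
  by rewrite mem_msubs; apply/msubsetP => i; rewrite msetE2 leq_addl.
by rewrite eqxx muln_eq0 negb_or cB.
Qed.

Lemma series_mulC c d : series_mul c d = series_mul d c.
Proof.
apply/funext => A; rewrite !(@series_mulE _ _ (msubs A)) ?msubs_uniq//;
  try by move=> B; rewrite mem_msubs.
rewrite (exchange_big_dep xpredT)//=; apply: eq_bigr => B _.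
by under eq_bigl do rewrite msetDC; under eq_bigr do rewrite mulnC.
Qed.

Lemma series_mul3E c d e A (D := msubs A) :
  series_mul c (series_mul d e) A =
  \sum_(B <- D) \sum_(C <- D) \sum_(E <- D | B `+` (C `+` E) == A)
    c B * (d C * e E).
Proof.
rewrite (@series_mulE _ _ D) ?msubs_uniq//; last by move=> B; rewrite mem_msubs.
apply: eq_bigr => B _.
have step C : C \in D -> series_mul d e C =
    \sum_(F <- D) \sum_(E <- D | F `+` E == C) d F * e E.
  rewrite mem_msubs => CA; rewrite (@series_mulE _ _ D) ?msubs_uniq// => F FC.
  by rewrite mem_msubs; apply: msubset_trans CA.
transitivity (\sum_(C <- D | B `+` C == A) \sum_(F <- D)
    \sum_(E <- D | F `+` E == C) c B * (d F * e E)).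
  rewrite [LHS]big_seq_cond [RHS]big_seq_cond; apply: eq_bigr => C /andP[CD _].
  rewrite step// big_distrr; apply: eq_bigr => F _ /=.
  by rewrite big_distrr.
rewrite exchange_big; apply: eq_bigr => F _.
under eq_bigr do rewrite big_mkcond.
rewrite exchange_big [RHS]big_mkcond /=; apply: eq_bigr => E _.
rewrite big_mkcond; case: ifPn => [/eqP FE|FE].
  rewrite (bigD1_seq (F `+` E)) ?msubs_uniq//=; last first.
    by rewrite mem_msubs -FE; apply/msubsetP => i; rewrite [X in _ <= X]msetE2 leq_addl.
  rewrite FE !eqxx big1 ?addn0// => G GFE.
  by rewrite [F `+` E == G]eq_sym (negPf GFE) if_same.
rewrite big1// => C _; case: eqP => // BC; case: eqP => // FEC.
by rewrite FEC BC eqxx in FE.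
Qed.

Lemma series_mulA c d e :
  series_mul c (series_mul d e) = series_mul (series_mul c d) e.
Proof.
apply/funext => A; rewrite [in RHS]series_mulC !series_mul3E.
rewrite [RHS]exchange_big; apply: eq_bigr => B _.
rewrite [RHS](exchange_big_dep xpredT)//=; apply: eq_bigr => C _.
apply: eq_big => [E|E _]; last by rewrite mulnA mulnC.
by rewrite msetDA msetDC.
Qed.

Lemma series_mulDl c d e :
  series_mul (series_add c d) e = series_add (series_mul c e) (series_mul d e).
Proof.
apply/funext => A; rewrite /series_add !(@series_mulE _ _ (msubs A)) ?msubs_uniq//;
  try by move=> B; rewrite mem_msubs.
rewrite -big_split; apply: eq_bigr => B _; rewrite -big_split.
by apply: eq_bigr => C _; rewrite mulnDl.
Qed.

Lemma series_mul0 c : series_mul series0 c = series0.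
Proof. by apply/funext => A; rewrite /series_mul fsbig1. Qed.

Lemma series_mul1 c : series_mul series1 c = c.
Proof.
apply/funext => A; rewrite (@series_mulE _ _ (msubs A)) ?msubs_uniq//;
  last by move=> B; rewrite mem_msubs.
rewrite (bigD1_seq mset0) ?msubs_uniq ?mem_msubs ?msub0set//=.
rewrite [X in _ + X]big1 ?addn0; last first.
  by move=> B /negPf B0; rewrite big1// => C _; rewrite /series1 B0 mul0n.
under eq_bigl do rewrite mset0D.
rewrite big_mkcond (bigD1_seq A) ?msubs_uniq ?mem_msubs ?msubset_refl//=.
by rewrite /series1 !eqxx big1 ?addn0 ?mul1n// => C /negPf ->.
Qed.

End SeriesTheory.

Section SymfunRig.
Implicit Types f g : symfun.

Fact symfun0_sym : symmetric_series series0. Proof. by []. Qed.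
Fact symfun0_bounded : bounded_degree series0. Proof. by exists 0. Qed.
Definition symfun0 := Symfun symfun0_sym symfun0_bounded.

Fact symfun1_sym : symmetric_series series1.
Proof.
by move=> s _ A; rewrite /series1 -!size_mset_eq0 size_msetmap.
Qed.
Fact symfun1_bounded : bounded_degree series1.
Proof. by exists 0 => A; rewrite /series1; case: (A =P mset0) => [->|]; rewrite ?size_mset0. Qed.
Definition symfun1 := Symfun symfun1_sym symfun1_bounded.

Fact symfun_add_sym f g : symmetric_series (series_add f g).
Proof. by move=> s bs A; rewrite /series_add !coef_sym. Qed.
Fact symfun_add_bounded f g : bounded_degree (series_add f g).
Proof.
have [m fm] := coef_bounded f; have [n gn] := coef_bounded g.
exists (m + n) => A; rewrite /series_add addn_eq0 negb_and => /orP[/fm|/gn] h.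
  exact: leq_trans (leq_addr _ _).
exact: leq_trans (leq_addl _ _).
Qed.
Definition symfun_add f g :=
  Symfun (@symfun_add_sym f g) (@symfun_add_bounded f g).

Fact symfun_mul_sym f g : symmetric_series (series_mul f g).
Proof.
move=> s bs A; have [t sK tK] := bs; rewrite /series_mul.
rewrite (@reindex_fsbig _ _ _ _ _
  (fun p : {mset nat} * {mset nat} => (msetmap s p.1, msetmap s p.2))
  [set p | p.1 `+` p.2 = A]) /=.
  by apply: eq_fsbigr => p _; rewrite /= !coef_sym.
split => [[B C] /= <-|[B C] [B' C'] _ _ /= [eB eC]|[B C] /= BC].
- by rewrite msetmapD.
- by rewrite -(msetmapK sK B) -(msetmapK sK C) eB eC !(msetmapK sK).
exists (msetmap t B, msetmap t C) => /=; last by rewrite !(msetmapK tK).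
by rewrite -msetmapD BC (msetmapK sK).
Qed.
Fact symfun_mul_bounded f g : bounded_degree (series_mul f g).
Proof.
have [m fm] := coef_bounded f; have [n gn] := coef_bounded g.
exists (m + n) => A /series_mul_neq0[B [C [-> /fm Bm /gn Cn]]].
by rewrite size_msetD leq_add.
Qed.
Definition symfun_mul f g :=
  Symfun (@symfun_mul_sym f g) (@symfun_mul_bounded f g).

Fact symfun_addA : associative symfun_add.
Proof. by move=> f g h; apply: symfunP => A /=; rewrite /series_add /= addnA. Qed.
Fact symfun_addC : commutative symfun_add.
Proof. by move=> f g; apply: symfunP => A /=; rewrite /series_add addnC. Qed.
Fact symfun_add0 : left_id symfun0 symfun_add.
Proof. by move=> f; apply: symfunP. Qed.
HB.instance Definition _ :=
  GRing.isNmodule.Build symfun symfun_addA symfun_addC symfun_add0.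

Fact symfun_mulA : associative symfun_mul.
Proof. by move=> f g h; apply: symfunP => A; rewrite /= series_mulA. Qed.
Fact symfun_mulC : commutative symfun_mul.
Proof. by move=> f g; apply: symfunP => A; rewrite /= series_mulC. Qed.
Fact symfun_mul1 : left_id symfun1 symfun_mul.
Proof. by move=> f; apply: symfunP => A; rewrite /= series_mul1. Qed.
Fact symfun_mulDl : left_distributive symfun_mul +%R.
Proof. by move=> f g h; apply: symfunP => A; rewrite /= series_mulDl. Qed.
Fact symfun_mul0 : left_zero 0%R symfun_mul.
Proof. by move=> f; apply: symfunP => A; rewrite /= series_mul0. Qed.
Fact symfun1_neq0 : symfun1 != 0%R.
Proof. by apply/eqP => /(congr1 (fun h => coef h mset0)) /=; rewrite /series1 eqxx. Qed.
HB.instance Definition _ := GRing.Nmodule_isComNzSemiRing.Build symfun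
  symfun_mulA symfun_mulC symfun_mul1 symfun_mulDl symfun_mul0 symfun1_neq0.

End SymfunRig.

(* Partitions are weakly decreasing lists of positive parts; the empty list,
   the partition of 0, is allowed here and excluded from [PP]. *)
Record intpart := IntPart {
  parts :> seq nat;
  partsP : sorted geq parts && (0 \notin parts) }.

HB.instance Definition _ := [isSub for parts].
HB.instance Definition _ := [Choice of intpart by <:].

Definition PP : set intpart := [set lam | parts lam != [::]].

Fact xmon_key : unit. Proof. exact: tt. Qed.

(* x_0 ^ s_0 * x_1 ^ s_1 * ... *)
Definition xmon (s : seq nat) : {mset nat} :=
  [mset[xmon_key] i in [fset i in iota 0 (size s)]%fset => nth 0 s i].

Definition perm_equiv (A B : {mset nat}) : Prop :=
  exists s : nat -> nat, bijective s /\ msetmap s A = B.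

Lemma perm_equiv_refl A : perm_equiv A A.
Proof. by exists id; split; [exists id | rewrite msetmap_id]. Qed.

Lemma perm_equiv_sym A B : perm_equiv A B -> perm_equiv B A.
Proof.
move=> [s [[t sK tK] <-]]; exists t; split; first by exists s.
by rewrite (msetmapK sK).
Qed.

Lemma perm_equiv_trans A B C :
  perm_equiv A B -> perm_equiv B C -> perm_equiv A C.
Proof.
move=> [s [bs <-]] [t [bt <-]]; exists (t \o s).
by rewrite msetmap_comp; split=> //; exact: bij_comp.
Qed.

Lemma perm_equivP A B : perm_equiv A B -> forall f : symfun, f A = f B.
Proof. by move=> [s [bs <-]] f; rewrite coef_sym. Qed.

Lemma size_perm_equiv A B : perm_equiv A B -> size A = size B.
Proof. by move=> [s [_ <-]]; rewrite size_msetmap. Qed.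

Lemma perm_equivE A B C : perm_equiv A B -> perm_equiv C A <-> perm_equiv C B.
Proof.
move=> AB; split => h; first exact: perm_equiv_trans AB.
exact: perm_equiv_trans (perm_equiv_sym AB).
Qed.

Section Orbit.
Variable A : {mset nat}.

Fact orbit_sum_sym : symmetric_series (fun B => `[< perm_equiv A B >]).
Proof.
move=> s bs B; congr nat_of_bool; apply: asbool_equiv_eq.
have BsB : perm_equiv B (msetmap s B) by exists s.
by rewrite -(perm_equivE _ BsB).
Qed.

Fact orbit_sum_bounded : bounded_degree (fun B => `[< perm_equiv A B >]).
Proof.
exists (size A) => B; rewrite eqb0 negbK => /asboolP /size_perm_equiv ->.
exact: leqnn.
Qed.

(* The sum of all distinct monomials obtained from the monomial [A] by
   permuting the variables. *)
Definition orbit_sum : symfun := Symfun orbit_sum_sym orbit_sum_bounded.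

End Orbit.

Definition msym (lam : intpart) : symfun := orbit_sum (xmon lam).

Lemma orbit_sum_neq0 A B : orbit_sum A B != 0 <-> perm_equiv A B.
Proof. by rewrite /= eqb0 negbK; split => /asboolP. Qed.

Lemma orbit_sum_equiv A B : perm_equiv A B -> orbit_sum A = orbit_sum B.
Proof.
move=> AB; apply: symfunP => C /=; congr nat_of_bool; apply: asbool_equiv_eq.
split=> h; first exact: perm_equiv_trans (perm_equiv_sym AB) h.
exact: perm_equiv_trans AB h.
Qed.

Lemma orbit_sum0 : orbit_sum mset0 = 1%R.
Proof.
apply: symfunP => B /=; rewrite /series1; congr nat_of_bool.
apply/asboolP/eqP => [[s [_ <-]]|->]; first by rewrite msetmap0.
exact: perm_equiv_refl.
Qed.

Lemma xmonE s i : xmon s i = nth 0 s i.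
Proof.
rewrite /xmon fsfunE in_fset /= mem_iota /= add0n.
by case: ltnP => // h; rewrite nth_default.
Qed.

Lemma xmon_nil : xmon [::] = mset0.
Proof. by apply/msetP => i; rewrite xmonE nth_nil mset0E. Qed.

Lemma geq_total : total geq.
Proof. by move=> m n; exact: leq_total. Qed.

Lemma geq_trans : transitive geq.
Proof. by move=> m n p /= h1 h2; exact: leq_trans h2 h1. Qed.

Lemma geq_anti : antisymmetric geq.
Proof. by move=> m n /= /andP[h1 h2]; apply/eqP; rewrite eqn_leq h1 h2. Qed.

Definition shape (A : {mset nat}) : seq nat :=
  sort geq [seq A i | i <- (finsupp A : seq nat)].

Fact shapeP A : sorted geq (shape A) && (0 \notin shape A).
Proof.
rewrite (sort_sorted geq_total) /= mem_sort; apply/mapP => -[i]; rewrite mem_finsupp => /eqP h e.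
exact/h/esym.
Qed.

Definition shape_part A : intpart := IntPart (shapeP A).

Lemma shape_inj (s : nat -> nat) A : injective s -> shape (msetmap s A) = shape A.
Proof.
move=> sI; apply/perm_sortP => //; [exact: geq_total|exact: geq_trans|exact: geq_anti|].
have -> : [seq A i | i <- (finsupp A : seq nat)] =
          [seq msetmap s A i | i <- [seq s i | i <- (finsupp A : seq nat)]].
  by rewrite -map_comp; apply: eq_map => i /=; rewrite msetmap_app.
apply: perm_map; apply: uniq_perm; first exact: fset_uniq.
  by rewrite map_inj_uniq // fset_uniq.
move=> j; apply/idP/mapP => [|[i iA ->]].
  rewrite msuppE /msetmap (perm_mem (perm_eq_seq_mset _)) => /mapP[i iA ->].
  by exists i; rewrite ?msuppE.
by rewrite msuppE mem_msetmap // -msuppE.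
Qed.

Lemma shape_xmon (lam : intpart) : shape (xmon lam) = lam.
Proof.
have /andP[lams lam0] := partsP lam.
rewrite -[RHS](sorted_sort geq_trans lams).
apply/perm_sortP => //; [exact: geq_total|exact: geq_trans|exact: geq_anti|].
rewrite -[X in perm_eq _ X](mkseq_nth 0) /mkseq.
rewrite (eq_map (xmonE lam)); apply: perm_map; apply: uniq_perm.
- exact: fset_uniq.
- exact: iota_uniq.
move=> i; rewrite mem_finsupp xmonE mem_iota /= add0n.
case: ltnP => [h|h]; last by rewrite nth_default.
by apply: contra lam0 => /eqP <-; exact: mem_nth.
Qed.

Lemma perm_equiv_shape A : perm_equiv (xmon (shape A)) A.
Proof.
pose r i j := geq (A i) (A j).
pose s := sort r (finsupp A).
have us : uniq s by rewrite sort_uniq fset_uniq.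
have sE : shape A = map A s by rewrite /shape sort_map.
pose N := (\max_(i <- s) i).+1.
have sN i : i \in s -> i < N by move=> h; rewrite ltnS; exact: leq_bigmax_seq.
pose t := s ++ [seq i <- iota 0 N | i \notin s].
have tP : perm_eq t (iota 0 N).
  apply: uniq_perm; last 1 first.
  - move=> i; rewrite mem_cat mem_filter mem_iota /= add0n.
    by case: (boolP (i \in s)) => // /sN ->.
  - rewrite cat_uniq us filter_uniq ?iota_uniq// andbT; apply/hasPn => i.
    by rewrite mem_filter => /andP[].
  - exact: iota_uniq.
have szt : size t = N by rewrite (perm_size tP) size_iota.
have ut : uniq t by rewrite (perm_uniq tP) iota_uniq.
have memt i : (i \in t) = (i < N) by rewrite (perm_mem tP) mem_iota.
pose f j := if j < N then nth 0 t j else j.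
pose g i := if i < N then index i t else i.
have fK : cancel f g.
  move=> j; rewrite /f /g; case: (ltnP j N) => jN; last by rewrite ltnNge jN.
  by rewrite -memt mem_nth ?szt// index_uniq ?szt.
have gK : cancel g f.
  move=> i; rewrite /f /g; case: (ltnP i N) => iN; last by rewrite ltnNge iN.
  by rewrite -{1}szt index_mem memt iN nth_index ?memt.
exists f; split; first by exists g.
apply/msetP => i; rewrite -(gK i) msetmap_app; last exact: can_inj fK.
rewrite xmonE sE; move: (g i) => j.
have [js|js] := ltnP j (size s).
  rewrite (nth_map 0)// /f ifT; first by rewrite /t nth_cat js.
  by rewrite -szt size_cat (leq_trans js)// leq_addr.
rewrite nth_default ?size_map//; apply/esym/mset_eq0P.
rewrite -msuppE -(mem_sort r) -/s /f; case: ifPn => jN; last first.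
  by apply/negP => /sN; rewrite (negPf jN).
rewrite /t nth_cat ltnNge js /=.
have : nth 0 [seq i <- iota 0 N | i \notin s] (j - size s) \in
    [seq i <- iota 0 N | i \notin s].
  by apply: mem_nth; rewrite ltn_subLR // -size_cat -/t szt.
by rewrite mem_filter => /andP[].
Qed.

Lemma perm_equiv_shapeP A B : perm_equiv A B <-> shape A = shape B.
Proof.
split=> [[s [bs <-]]|AB]; first by rewrite shape_inj//; exact: bij_inj.
apply: perm_equiv_trans (perm_equiv_shape B); rewrite -AB.
exact/perm_equiv_sym/perm_equiv_shape.
Qed.

Lemma perm_equiv_inj (s : nat -> nat) A :
  injective s -> perm_equiv A (msetmap s A).
Proof. by move=> sI; apply/perm_equiv_shapeP; rewrite shape_inj. Qed.

Lemma orbit_sum_shape A : orbit_sum A = msym (shape_part A).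
Proof. exact/orbit_sum_equiv/perm_equiv_sym/perm_equiv_shape. Qed.

Lemma msymE (lam mu : intpart) : msym lam (xmon mu) = (lam == mu).
Proof.
rewrite /=; congr nat_of_bool; apply/asboolP/eqP => [/perm_equiv_shapeP|->].
  by rewrite !shape_xmon => /val_inj.
exact: perm_equiv_refl.
Qed.

Lemma size_iota_supp (lam : intpart) : size lam <= size (xmon lam).
Proof.
have /andP[_ lam0] := partsP lam.
rewrite -(size_iota 0 (size lam)); apply: uniq_leq_size; first exact: iota_uniq.
move=> i; rewrite mem_iota /= add0n -mset_neq0 xmonE => h.
by apply: contra lam0 => /eqP <-; exact: mem_nth.
Qed.

Lemma finite_intpart d : finite_set [set lam : intpart | size (xmon lam) <= d].
Proof.
apply: sub_finite_set (finite_image shape_part (finite_mset (iota 0 d) d)).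
move=> lam /= lamd; exists (xmon lam); last first.
  by apply: val_inj; rewrite /= shape_xmon.
split=> // i; rewrite mem_iota /= add0n -mset_neq0 xmonE => h.
apply: leq_trans lamd; apply: leq_trans (size_iota_supp lam).
by rewrite ltnNge; apply: contra h => h; rewrite nth_default.
Qed.

Definition parts_upto d : seq intpart := fset_set [set lam : intpart | size (xmon lam) <= d].

Lemma mem_parts_upto d lam : (lam \in parts_upto d) = (size (xmon lam) <= d).
Proof.
by rewrite in_fset_set; [apply/idP/idP; rewrite inE|exact: finite_intpart].
Qed.

Lemma coef_sum (I : Type) (r : seq I) (F : I -> symfun) A :
  (\sum_(i <- r) F i)%R A = \sum_(i <- r) F i A.
Proof. by elim: r => [|i r IHr]; rewrite ?big_nil ?big_cons -?IHr. Qed.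

Lemma coef_muln (f : symfun) n A : (f *+ n)%R A = n * f A.
Proof. by elim: n => [|n IHn]; rewrite ?mul0n// mulrS mulSn -IHn. Qed.

(* The m_lam, together with 1 = m_[::], form a basis over nat of Lambda. *)
Lemma msym_basis (f : symfun) d : (forall A, f A != 0 -> size A <= d) ->
  f = (\sum_(lam <- parts_upto d) msym lam *+ f (xmon lam))%R.
Proof.
move=> fd; apply: symfunP => A; rewrite coef_sum.
under eq_bigr do rewrite coef_muln.
have eA := perm_equiv_shape A; rewrite -(perm_equivP eA).
under eq_bigr do rewrite -(perm_equivP eA) -[shape A]/(val (shape_part A)) msymE.
rewrite -[shape A]/(val (shape_part A)).
have [h|h] := boolP (shape_part A \in parts_upto d); last first.
  rewrite big1_seq => [|lam /andP[_ lamd]]; last first.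
    by case: (lam =P _) => [e|_]; [rewrite -e lamd in h|rewrite muln0].
  by apply/eqP; apply: contraNT h => /fd; rewrite mem_parts_upto.
rewrite (bigD1_seq (shape_part A)) ?fset_uniq//= eqxx muln1 big1 ?addn0//.
by move=> lam /negPf ->; rewrite muln0.
Qed.

(* The Lawvere quantale [0, +oo]; as a rig its addition is min (with zero +oo)
   and its multiplication is + (with unit 0). *)
Record lawvere (R : realType) := Lawvere {
  lval : \bar R;
  lval_ge0 : (0%E <= lval)%E }.

HB.instance Definition _ (R : realType) := [isSub of lawvere R for @lval R].
HB.instance Definition _ (R : realType) := [Choice of lawvere R by <:].

Section LawvereRig.
Context {R : realType}.
Implicit Types x y z : lawvere R.

Lemma lval_inj x y : lval x = lval y -> x = y.
Proof. exact: val_inj. Qed.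

Lemma lle_anti x y : (lval x <= lval y)%E -> (lval y <= lval x)%E -> x = y.
Proof. by move=> xy yx; apply/lval_inj/le_anti; rewrite xy yx. Qed.

Fact lawvere_pinfty_ge0 : (0%E <= +oo%E :> \bar R)%E.
Proof. exact: leey. Qed.
Definition lawvere_zero := Lawvere lawvere_pinfty_ge0.

Definition lawvere_one := Lawvere (lexx (0%E : \bar R)).

Fact lawvere_add_ge0 x y : (0%E <= Order.min (lval x) (lval y))%E.
Proof. by rewrite le_min !lval_ge0. Qed.
Definition lawvere_add x y := Lawvere (lawvere_add_ge0 x y).

Fact lawvere_mul_ge0 x y : (0%E <= lval x + lval y)%E.
Proof. by rewrite adde_ge0 ?lval_ge0. Qed.
Definition lawvere_mul x y := Lawvere (lawvere_mul_ge0 x y).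

Fact lawvere_addA : associative lawvere_add.
Proof. by move=> x y z; apply: lval_inj; rewrite /= minA. Qed.
Fact lawvere_addC : commutative lawvere_add.
Proof. by move=> x y; apply: lval_inj; rewrite /= minC. Qed.
Fact lawvere_add0 : left_id lawvere_zero lawvere_add.
Proof. by move=> x; apply: lval_inj; rewrite /=; apply/min_idPr; exact: leey. Qed.
HB.instance Definition _ := GRing.isNmodule.Build (lawvere R)
  lawvere_addA lawvere_addC lawvere_add0.

Fact lawvere_mulA : associative lawvere_mul.
Proof. by move=> x y z; apply: lval_inj; rewrite /= addeA. Qed.
Fact lawvere_mulC : commutative lawvere_mul.
Proof. by move=> x y; apply: lval_inj; rewrite /= addeC. Qed.
Fact lawvere_mul1 : left_id lawvere_one lawvere_mul.
Proof. by move=> x; apply: lval_inj; rewrite /= add0e. Qed.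
Fact lawvere_mulDl : left_distributive lawvere_mul +%R.
Proof.
move=> x y z; apply: lval_inj => /=.
have [xy|yx] := leP (lval x) (lval y).
  by rewrite (min_idPl _)// leeD2r.
by rewrite (min_idPr _)// leeD2r// ltW.
Qed.
Fact lawvere_mul0 : left_zero 0%R lawvere_mul.
Proof.
move=> x; apply: lval_inj; rewrite /= addye//.
by apply: contraTneq (lval_ge0 x) => ->.
Qed.
Fact lawvere_one_neq0 : lawvere_one != 0%R.
Proof. by apply/eqP => /(congr1 (@lval R)). Qed.
HB.instance Definition _ := GRing.Nmodule_isComNzSemiRing.Build (lawvere R)
  lawvere_mulA lawvere_mulC lawvere_mul1 lawvere_mulDl lawvere_mul0
  lawvere_one_neq0.

Lemma lvalD x y : lval (x + y)%R = Order.min (lval x) (lval y). Proof. by []. Qed.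
Lemma lvalM x y : lval (x * y)%R = (lval x + lval y)%E. Proof. by []. Qed.
Lemma lval0 : lval (0%R : lawvere R) = +oo%E. Proof. by []. Qed.
Lemma lval1 : lval (1%R : lawvere R) = 0%E. Proof. by []. Qed.

Lemma lval_le0 x : (lval x <= lval (0%R : lawvere R))%E.
Proof. by rewrite lval0 leey. Qed.

Lemma lawvere_muln x n : (x *+ n)%R = if n == 0 then 0%R else x.
Proof.
elim: n => [|[|n] IHn]; rewrite ?mulr0n ?mulr1n// mulrS IHn /=.
by apply: lval_inj; rewrite lvalD minxx.
Qed.

Lemma lawvere_sum_lb (I : eqType) (r : seq I) (F : I -> lawvere R) (n : I -> nat) i :
  i \in r -> n i != 0 -> (lval (\sum_(j <- r) F j *+ n j)%R <= lval (F i))%E.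
Proof.
elim: r => // j r IHr; rewrite inE big_cons lvalD ge_min => /orP[/eqP <- h|ir h].
  by rewrite lawvere_muln (negPf h) lexx.
by rewrite IHr// orbT.
Qed.

Lemma lawvere_sum_att (I : eqType) (r : seq I) (F : I -> lawvere R) (n : I -> nat) :
  (\sum_(j <- r) F j *+ n j = 0)%R \/
  exists i, [/\ i \in r, n i != 0 & (\sum_(j <- r) F j *+ n j = F i)%R].
Proof.
elim: r => [|j r IHr]; first by left; rewrite big_nil.
rewrite big_cons lawvere_muln; case: ifPn => [_|nj].
  rewrite add0r; case: IHr => [->|[i [ir ni ->]]]; first by left.
  by right; exists i; rewrite inE ir orbT.
right; set S := (\sum_(_ <- _) _)%R in IHr *.
have [h|h] := leP (lval (F j)) (lval S).
  exists j; rewrite mem_head; split=> //; apply: lval_inj.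
  by rewrite lvalD; apply/min_idPl.
case: IHr => [S0|[i [ir ni Si]]].
  by move: h; rewrite S0 ltNge lval_le0.
exists i; rewrite inE ir orbT; split=> //; rewrite -Si; apply: lval_inj.
by rewrite lvalD; apply/min_idPr/ltW.
Qed.

End LawvereRig.

Notation witt R := {rmorphism symfun -> lawvere R}.

Section Hom.
Context {R : realType}.
Implicit Types f g k : witt R.

Lemma hom_sumE f (h : symfun) : exists d, (forall A, h A != 0 -> size A <= d) /\
  f h = (\sum_(lam <- parts_upto d) f (msym lam) *+ h (xmon lam))%R.
Proof.
have [d hd] := coef_bounded h; exists d; split=> //.
by rewrite {1}(msym_basis hd) rmorph_sum; apply: eq_bigr => lam _; rewrite rmorphMn.
Qed.

Lemma hom_lb f (h : symfun) A :
  h A != 0 -> (lval (f h) <= lval (f (orbit_sum A)))%E.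
Proof.
move=> hA; have [d [hd ->]] := hom_sumE f h; rewrite orbit_sum_shape.
have e : h (xmon (shape_part A)) = h A by exact/perm_equivP/perm_equiv_shape.
apply: (@lawvere_sum_lb R _ _ (fun lam => f (msym lam)) (fun lam : intpart => h (xmon lam))).
  by rewrite mem_parts_upto hd// e.
by rewrite e.
Qed.

Lemma hom_att f (h : symfun) : f h = 0%R \/
  exists A, h A != 0 /\ f h = f (orbit_sum A).
Proof.
have [d [hd ->]] := hom_sumE f h.
case: (@lawvere_sum_att R _ (parts_upto d) (fun lam => f (msym lam))
  (fun lam : intpart => h (xmon lam))) => [->|[lam [_ hlam ->]]]; first by left.
by right; exists (xmon lam).
Qed.

Lemma orbit_sumM_neq0 A B C :
  (orbit_sum A * orbit_sum B)%R C != 0 <->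
  exists A' B', [/\ perm_equiv A A', perm_equiv B B' & C = A' `+` B'].
Proof.
rewrite series_mul_neq0; split=> -[A' [B' [h1 h2 h3]]]; exists A', B'.
  by split; [exact/orbit_sum_neq0|exact/orbit_sum_neq0|].
by split=> //; exact/orbit_sum_neq0.
Qed.

Lemma hom_orbitD_lb f A B :
  (lval (f (orbit_sum A)) + lval (f (orbit_sum B)) <=
   lval (f (orbit_sum (A `+` B))))%E.
Proof.
rewrite -lvalM -rmorphM; apply: hom_lb; apply/orbit_sumM_neq0.
by exists A, B; split=> //; exact: perm_equiv_refl.
Qed.

Lemma hom_orbitD_att f A B : (f (orbit_sum A) * f (orbit_sum B) = 0)%R \/
  exists A' B', [/\ perm_equiv A A', perm_equiv B B' &
   (f (orbit_sum A) * f (orbit_sum B) = f (orbit_sum (A' `+` B')))%R].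
Proof.
rewrite -rmorphM; case: (hom_att f (orbit_sum A * orbit_sum B)%R) => [->|].
  by left.
move=> [C [/orbit_sumM_neq0[A' [B' [hA hB ->]]] ->]].
by right; exists A', B'.
Qed.

Lemma witt_ext f g : (forall lam, PP lam -> f (msym lam) = g (msym lam)) -> f = g.
Proof.
move=> fg; have {}fg lam : f (msym lam) = g (msym lam).
  have [lam0|lam0] := eqVneq (parts lam) [::]; last exact: fg.
  by rewrite /msym lam0 xmon_nil orbit_sum0 !rmorph1.
have {fg} : f =1 g.
  move=> h; have [d hd] := coef_bounded h; rewrite (msym_basis hd) !rmorph_sum.
  by apply: eq_bigr => lam _; rewrite !rmorphMn fg.
case: f g => [f [[f1] [f2]]] [g [[g1] [g2]]] /= /funext fg; subst g.
by rewrite (Prop_irrelevance f1 g1) (Prop_irrelevance f2 g2).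
Qed.

End Hom.

(* An element of Lambda (x) Lambda is identified with a series in two alphabets
   x, y, so that m_mu (x) m_mu' is m_mu(x) m_mu'(y) (cf. [comult_msym_expand]).
   [comult h B C] is the coefficient of x^B y^C in h((x_i y_j)_(i, j)): the
   variables of h are enumerated by pairs (i, j) along Cantor's bijection (which
   one does not matter as h is symmetric), and a monomial A in the x_i y_j
   becomes x^B y^C, with B and C the row and column sums of A. *)
Definition comult (h : symfun) (B C : {mset nat}) : nat :=
  \big[addn/0]_(A \in [set A : {mset nat * nat} |
                        msetmap fst A = B /\ msetmap snd A = C])
    h (msetmap to_nat A).

(* The value on h of Delta followed by f (x) g and the product of the rig:
   if Delta(h) = \sum c_(mu, mu') m_mu (x) m_mu', this is
   \sum c_(mu, mu') f(m_mu) g(m_mu'). *)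
Definition witt_mul_fun (R : realType) (f g : witt R) (h : symfun) : lawvere R :=
  (\sum_(p \in [set: intpart * intpart])
    (f (msym p.1) * g (msym p.2)) *+ comult h (xmon p.1) (xmon p.2))%R.

(* The counit h |-> h(1, 0, 0, ...), followed by the rig map nat -> lawvere R. *)
Definition witt_one_fun (R : realType) (h : symfun) : lawvere R :=
  if `[< exists n, h (msetn n 0) != 0 >] then 1%R else 0%R.

Section Comult.

Local Arguments to_nat : simpl never.
Local Arguments of_nat : simpl never.

Lemma to_natK : cancel to_nat of_nat. Proof. exact: cancel_of_to. Qed.
Lemma of_natK : cancel of_nat to_nat. Proof. exact: cancel_to_of. Qed.
Lemma to_nat_bij : bijective to_nat.
Proof. by exists of_nat; [exact: to_natK|exact: of_natK]. Qed.

Lemma symfun_pair (h : symfun) (s : nat * nat -> nat * nat) A :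
  bijective s -> h (msetmap to_nat (msetmap s A)) = h (msetmap to_nat A).
Proof.
move=> bs; apply: perm_equivP; apply: perm_equiv_sym.
exists (to_nat \o s \o of_nat); split.
  apply: bij_comp; first exact: bij_comp to_nat_bij bs.
  by exists to_nat; [exact: of_natK|exact: to_natK].
by rewrite !msetmap_comp; apply: eq_msetmap => p /=; rewrite to_natK.
Qed.

Lemma comult_neq0 (h : symfun) B C : comult h B C != 0 <->
  exists A : {mset nat * nat}, [/\ msetmap fst A = B, msetmap snd A = C &
    h (msetmap to_nat A) != 0].
Proof.
rewrite /comult fsbig_finite; last exact: finite_margins.
rewrite sum_nat_seq_neq0; split.
  move=> /hasP[A]; rewrite in_fset_set; last exact: finite_margins.
  by rewrite inE => -[AB AC] /= hA; exists A.
move=> [A [AB AC hA]]; apply/hasP; exists A => //.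
by rewrite in_fset_set; [apply: mem_set|exact: finite_margins].
Qed.

Lemma comult_equiv (h : symfun) B B' C C' :
  perm_equiv B B' -> perm_equiv C C' -> comult h B C = comult h B' C'.
Proof.
move=> [s [bs <-]] [t [bt <-]]; rewrite /comult.
have [s' sK s'K] := bs; have [t' tK t'K] := bt.
pose u (p : nat * nat) := (s p.1, t p.2).
pose v (p : nat * nat) := (s' p.1, t' p.2).
have uK : cancel u v by move=> [i j]; rewrite /u /v /= sK tK.
have vK : cancel v u by move=> [i j]; rewrite /u /v /= s'K t'K.
have bu : bijective u by exists v.
rewrite [RHS](@reindex_fsbig _ _ _ _ _ (msetmap u)
  [set A | msetmap fst A = B /\ msetmap snd A = C]) /=.
  by apply: eq_fsbigr => A _; rewrite symfun_pair.
split=> [A [<- <-]|A A' _ _|A [AB AC]] /=.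
- by rewrite !msetmap_comp; split; apply: eq_msetmap.
- exact: can_inj (msetmapK uK) A A'.
exists (msetmap v A); last exact: (msetmapK vK).
split; rewrite msetmap_comp.
  rewrite -(msetmapK sK B) -AB msetmap_comp; exact: eq_msetmap.
rewrite -(msetmapK tK C) -AC msetmap_comp; exact: eq_msetmap.
Qed.

Lemma comult_bounded (h : symfun) : exists d, forall B C,
  comult h B C != 0 -> size B <= d /\ size C <= d.
Proof.
have [d hd] := coef_bounded h; exists d => B C /comult_neq0[A [<- <- /hd]].
by rewrite !size_msetmap.
Qed.

Lemma finite_comult (h : symfun) : finite_set
  [set p : intpart * intpart | comult h (xmon p.1) (xmon p.2) != 0].
Proof.
have [d hd] := comult_bounded h.
by apply: sub_finite_set (finite_setX (finite_intpart d) (finite_intpart d))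
  => -[B C] /hd.
Qed.

(* Delta(h) is the combination of the m_mu (x) m_mu' with coefficients
   [comult h (xmon mu) (xmon mu')]; by [msymE] no other family of coefficients
   will do. *)
Lemma comult_msym_expand (h : symfun) B C :
  comult h B C = \big[addn/0]_(p \in [set: intpart * intpart])
    (comult h (xmon p.1) (xmon p.2) * (msym p.1 B * msym p.2 C)).
Proof.
have eB := perm_equiv_shape B; have eC := perm_equiv_shape C.
have E lam mu : msym lam B * msym mu C =
    ((lam, mu) == (shape_part B, shape_part C)).
  rewrite -(perm_equivP eB) -(perm_equivP eC).
  rewrite -[shape B]/(val (shape_part B)) -[shape C]/(val (shape_part C)).
  by rewrite !msymE mulnb xpair_eqE.
rewrite (fsbigE [:: (shape_part B, shape_part C)])//; last first.
  move=> [lam mu] _ /=; rewrite inE => /negPf h0.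
  by rewrite E h0 muln0.
rewrite big_mkcond big_seq1 ifT; last exact: mem_set.
rewrite E eqxx muln1.
by apply/esym/comult_equiv.
Qed.

End Comult.

Section WittMul.
Context {R : realType}.
Implicit Types f g k : witt R.

Let G f g (A : {mset nat * nat}) : lawvere R :=
  (f (orbit_sum (msetmap fst A)) * g (orbit_sum (msetmap snd A)))%R.

Lemma witt_mul_finE f g h :
  witt_mul_fun f g h = (\sum_(p <- fset_set [set p : intpart * intpart |
    comult h (xmon p.1) (xmon p.2) != 0])
    (f (msym p.1) * g (msym p.2)) *+ comult h (xmon p.1) (xmon p.2))%R.
Proof.
rewrite /witt_mul_fun (fsbigE (fset_set [set p : intpart * intpart |
    comult h (xmon p.1) (xmon p.2) != 0]))//.
- by apply: eq_bigl => p; exact: mem_set.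
- move=> p _; rewrite in_fset_set; last exact: finite_comult.
  rewrite notin_setE /= => /negP; rewrite negbK => /eqP ->.
  by rewrite mulr0n.
Qed.

Lemma witt_mul_lb f g (h : symfun) A : h (msetmap to_nat A) != 0 ->
  (lval (witt_mul_fun f g h) <= lval (G f g A))%E.
Proof.
move=> hA; rewrite witt_mul_finE /G !orbit_sum_shape.
set B := msetmap fst A; set C := msetmap snd A.
have h0 : comult h (xmon (shape_part B)) (xmon (shape_part C)) != 0.
  rewrite (comult_equiv h (perm_equiv_shape B) (perm_equiv_shape C)).
  by apply/comult_neq0; exists A.
apply: (@lawvere_sum_lb R _ _ (fun p => f (msym p.1) * g (msym p.2))%R
  (fun p : intpart * intpart => comult h (xmon p.1) (xmon p.2))
  (shape_part B, shape_part C)) => //.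
by rewrite in_fset_set; [apply: mem_set|exact: finite_comult].
Qed.

Lemma witt_mul_att f g (h : symfun) : witt_mul_fun f g h = 0%R \/
  exists A, h (msetmap to_nat A) != 0 /\ witt_mul_fun f g h = G f g A.
Proof.
rewrite witt_mul_finE.
case: (@lawvere_sum_att R _ (fset_set [set p : intpart * intpart |
    comult h (xmon p.1) (xmon p.2) != 0]) (fun p => f (msym p.1) * g (msym p.2))%R
  (fun p : intpart * intpart => comult h (xmon p.1) (xmon p.2))) => [->|].
  by left.
move=> [[lam mu] [_ /= /comult_neq0[A [Alam Amu hA]] ->]].
by right; exists A; split=> //; rewrite /G Alam Amu.
Qed.

Lemma witt_mul_le f g (h : symfun) x :
  (forall A, h (msetmap to_nat A) != 0 -> (lval x <= lval (G f g A))%E) ->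
  (lval x <= lval (witt_mul_fun f g h))%E.
Proof.
move=> xG; case: (witt_mul_att f g h) => [->|[A [hA ->]]]; last exact: xG.
exact: lval_le0.
Qed.

Lemma lval_le_mul (x x' y y' : lawvere R) :
  (lval x <= lval x' -> lval y <= lval y' -> lval (x * y)%R <= lval (x' * y')%R)%E.
Proof. by move=> h1 h2; rewrite !lvalM leeD. Qed.

Lemma witt_mulD f g (h k : symfun) :
  witt_mul_fun f g (h + k)%R = (witt_mul_fun f g h + witt_mul_fun f g k)%R.
Proof.
apply: lle_anti; last first.
  apply: witt_mul_le => A; rewrite lvalD ge_min.
  rewrite /= /series_add addn_eq0 negb_and => /orP[] hA.
    by rewrite (witt_mul_lb f g hA).
  by rewrite (witt_mul_lb f g hA) orbT.
rewrite lvalD le_min; apply/andP; split; apply: witt_mul_le => A hA.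
  by apply: witt_mul_lb; rewrite /= /series_add addn_eq0 negb_and hA.
by apply: witt_mul_lb; rewrite /= /series_add addn_eq0 negb_and hA orbT.
Qed.

Lemma witt_mul_0 f g : witt_mul_fun f g 0%R = 0%R.
Proof. by case: (witt_mul_att f g 0%R) => // -[A []]. Qed.

Lemma witt_mul_1 f g : witt_mul_fun f g 1%R = 1%R.
Proof.
have G0 : G f g mset0 = 1%R.
  by rewrite /G !msetmap0 orbit_sum0 !rmorph1 mulr1.
apply: lle_anti.
  rewrite -[in X in (_ <= X)%E]G0; apply: witt_mul_lb.
  by rewrite msetmap0 /= /series1 eqxx.
apply: witt_mul_le => A hA; suff -> : A = mset0 by rewrite G0.
apply/eqP; rewrite -size_mset_eq0 -(size_msetmap to_nat) size_mset_eq0.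
by move: hA; rewrite /= /series1; case: (msetmap to_nat A == mset0).
Qed.

Lemma bij_pair (s t : nat -> nat) :
  bijective s -> bijective t -> bijective (fun p : nat * nat => (s p.1, t p.2)).
Proof.
move=> [s' sK s'K] [t' tK t'K]; exists (fun p => (s' p.1, t' p.2)) => -[i j] /=.
  by rewrite sK tK.
by rewrite s'K t'K.
Qed.

Lemma witt_mulM f g (h k : symfun) :
  witt_mul_fun f g (h * k)%R = (witt_mul_fun f g h * witt_mul_fun f g k)%R.
Proof.
apply: lle_anti; last first.
  apply: witt_mul_le => A /series_mul_neq0[B [C [ABC hB kC]]].
  have -> : A = msetmap of_nat B `+` msetmap of_nat C.
    by rewrite -msetmapD -ABC (msetmapK to_natK).
  set B' := msetmap of_nat B; set C' := msetmap of_nat C.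
  apply: (@le_trans _ _ (lval (G f g B' * G f g C')%R)).
    apply: lval_le_mul; apply: witt_mul_lb.
      by rewrite (msetmapK of_natK).
    by rewrite (msetmapK of_natK).
  rewrite /G mulrACA !msetmapD; apply: lval_le_mul;
    rewrite lvalM; exact: hom_orbitD_lb.
case: (witt_mul_att f g h) => [->|[A [hA ->]]]; first by rewrite mul0r lval_le0.
case: (witt_mul_att f g k) => [->|[B [kB ->]]]; first by rewrite mulr0 lval_le0.
rewrite {1 2}/G mulrACA.
case: (hom_orbitD_att f (msetmap fst A) (msetmap fst B)) => [->|].
  by rewrite mul0r lval_le0.
move=> [_ [_ [[s [bs <-]] [t [bt <-]] ->]]].
case: (hom_orbitD_att g (msetmap snd A) (msetmap snd B)) => [->|].
  by rewrite mulr0 lval_le0.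
move=> [_ [_ [[s' [bs' <-]] [t' [bt' <-]] ->]]].
pose u (p : nat * nat) := (s p.1, s' p.2).
pose v (p : nat * nat) := (t p.1, t' p.2).
have /(_ (msetmap u A `+` msetmap v B)) := @witt_mul_lb f g (h * k)%R.
rewrite /G !msetmapD !msetmap_comp; apply.
apply/series_mul_neq0; exists (msetmap to_nat (msetmap u A)),
  (msetmap to_nat (msetmap v B)); split.
- by rewrite !msetmap_comp.
- by rewrite symfun_pair//; exact: bij_pair.
- by rewrite symfun_pair//; exact: bij_pair.
Qed.

HB.instance Definition _ f g := GRing.isNmodMorphism.Build symfun (lawvere R)
  (witt_mul_fun f g) (witt_mul_0 f g, witt_mulD f g).
HB.instance Definition _ f g := GRing.isMonoidMorphism.Build symfun (lawvere R)
  (witt_mul_fun f g) (witt_mul_1 f g, witt_mulM f g).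

Definition witt_mul f g : witt R := witt_mul_fun f g.

End WittMul.

Lemma msetnD (I : choiceType) (i : I) m n :
  msetn (m + n) i = msetn m i `+` msetn n i.
Proof. by apply/msetP => j; rewrite msetE2 !msetnE; case: eqP. Qed.

Lemma msetnP1 (I : choiceType) (i : I) (A : {mset I}) :
  (forall j, j \in A -> j = i) -> A = msetn (size A) i.
Proof.
move=> h; rewrite -[LHS]seq_mset_id -[RHS]seq_mset_id enum_msetn.
by congr seq_mset; apply/all_pred1P/allP => j /h /= ->.
Qed.

Lemma msetmap_msetn (I J : choiceType) (f : I -> J) n i :
  msetmap f (msetn n i) = msetn n (f i).
Proof.
by rewrite /msetmap enum_msetn map_nseq -(enum_msetn n (f i)) seq_mset_id.
Qed.

Lemma msetn_split (I : choiceType) (i : I) n (A B : {mset I}) :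
  msetn n i = A `+` B -> A = msetn (size A) i /\ B = msetn (size B) i.
Proof.
move=> e; split; apply: msetnP1 => j h; have : j \in msetn n i.
- by rewrite e in_msetD h.
- by rewrite in_msetn => /andP[_ /eqP].
- by rewrite e in_msetD h orbT.
- by rewrite in_msetn => /andP[_ /eqP].
Qed.

Section WittOne.
Context {R : realType}.

Let W1 := @witt_one_fun R.

Lemma witt_one_eq1 (h : symfun) n : h (msetn n 0) != 0 -> W1 h = 1%R.
Proof. by move=> hn; rewrite /W1 /witt_one_fun asboolT//; exists n. Qed.

Lemma witt_one_eq0 (h : symfun) : (forall n, h (msetn n 0) = 0) -> W1 h = 0%R.
Proof.
by move=> hn; rewrite /W1 /witt_one_fun asboolF// => -[n]; rewrite hn.
Qed.

Lemma witt_oneP (h : symfun) : (exists n, h (msetn n 0) != 0) \/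
  (forall n, h (msetn n 0) = 0).
Proof.
have [H|H] := pselect (exists n, h (msetn n 0) != 0); [by left|right] => n.
by apply/eqP; apply/negPn/negP => hn; apply: H; exists n.
Qed.

Fact witt_one_0 : W1 0%R = 0%R.
Proof. exact: witt_one_eq0. Qed.

Fact witt_one_1 : W1 1%R = 1%R.
Proof. by apply: (@witt_one_eq1 _ 0); rewrite msetn0 /= /series1 eqxx. Qed.

Fact witt_one_D : {morph W1 : h k / (h + k)%R}.
Proof.
move=> h k; have [[n hn]|h0] := witt_oneP h.
  have hkn : (h + k)%R (msetn n 0) != 0.
    by rewrite /= /series_add addn_eq0 negb_and hn.
  rewrite (witt_one_eq1 hn) (witt_one_eq1 hkn); apply: lval_inj.
  by rewrite lvalD; apply/esym/min_idPl; rewrite lval1 lval_ge0.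
rewrite (witt_one_eq0 h0) add0r; have [[n kn]|k0] := witt_oneP k.
  have hkn : (h + k)%R (msetn n 0) != 0.
    by rewrite /= /series_add addn_eq0 negb_and kn orbT.
  by rewrite (witt_one_eq1 kn) (witt_one_eq1 hkn).
rewrite (witt_one_eq0 k0); apply: witt_one_eq0 => n.
by rewrite /= /series_add h0 k0.
Qed.

Fact witt_one_M : {morph W1 : h k / (h * k)%R}.
Proof.
move=> h k; have [[n hn]|h0] := witt_oneP h; last first.
  rewrite (witt_one_eq0 h0) mul0r; apply: witt_one_eq0 => n; apply/eqP.
  apply/negPn/negP => /series_mul_neq0[A [B [/msetn_split[-> _]]]].
  by rewrite h0.
have [[m km]|k0] := witt_oneP k; last first.
  rewrite (witt_one_eq0 k0) mulr0; apply: witt_one_eq0 => m; apply/eqP.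
  apply/negPn/negP => /series_mul_neq0[A [B [/msetn_split[_ ->]]]].
  by rewrite k0.
have hkn : (h * k)%R (msetn (n + m) 0) != 0.
  apply/series_mul_neq0; exists (msetn n 0), (msetn m 0).
  by rewrite msetnD.
by rewrite (witt_one_eq1 hn) (witt_one_eq1 km) (witt_one_eq1 hkn) mulr1.
Qed.

HB.instance Definition _ := GRing.isNmodMorphism.Build symfun (lawvere R)
  (@witt_one_fun R) (witt_one_0, witt_one_D).
HB.instance Definition _ := GRing.isMonoidMorphism.Build symfun (lawvere R)
  (@witt_one_fun R) (witt_one_1, witt_one_M).

Definition witt_one : witt R := @witt_one_fun R.

Lemma witt_one_att (h : symfun) :
  witt_one h = 0%R \/ (witt_one h = 1%R /\ exists n, h (msetn n 0) != 0).
Proof.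
have [[n hn]|h0] := witt_oneP h; last by left; exact: witt_one_eq0.
by right; split; [exact: witt_one_eq1 hn|exists n].
Qed.

Lemma witt_one_msym (lam : intpart) : PP lam ->
  lval (witt_one (msym lam)) = if parts lam is [:: _] then 0%E else +oo%E.
Proof.
have /andP[_] := partsP lam; rewrite /PP /=.
case lamE: (parts lam) => [//|n [|m s]] lam0 _.
  rewrite [witt_one _](@witt_one_eq1 _ n)//; apply/orbit_sum_neq0.
  suff -> : xmon lam = msetn n 0 by exact: perm_equiv_refl.
  apply/msetP => i; rewrite xmonE lamE msetnE; case: i => [|i] //=.
  by rewrite nth_nil.
rewrite [witt_one _]witt_one_eq0// => k; apply/eqP/negPn/negP => /orbit_sum_neq0.
move=> [t [bt e]]; have tI := bij_inj bt.
have P i : i < 2 -> t i = 0.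
  move=> i2; have : t i \in msetn k 0.
    rewrite -e mem_msetmap// -mset_neq0 xmonE lamE.
    have : nth 0 [:: n, m & s] i \in [:: n, m & s] by apply: mem_nth; exact: leq_trans i2 _.
    by apply: contraTneq => ->.
  by rewrite in_msetn => /andP[_ /eqP].
by have /tI := etrans (P 0 isT) (esym (P 1 isT)).
Qed.

End WittOne.

Section WittLaws.

Local Arguments to_nat : simpl never.
Local Arguments of_nat : simpl never.
Context {R : realType}.
Implicit Types f g k : witt R.

Lemma witt_mulC_le f g (h : symfun) :
  (lval (witt_mul f g h) <= lval (witt_mul g f h))%E.
Proof.
apply: witt_mul_le => A hA; pose sw (p : nat * nat) := (p.2, p.1).
have swK : cancel sw sw by case.
have := @witt_mul_lb R f g h (msetmap sw A).
rewrite symfun_pair; last by exists sw.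
by move=> /(_ hA); rewrite !msetmap_comp mulrC.
Qed.

Lemma witt_mulC f g : witt_mul f g = witt_mul g f.
Proof. by apply: witt_ext => lam _; apply: lle_anti; exact: witt_mulC_le. Qed.

Lemma witt_mulA_le f g k (h : symfun) :
  (lval (witt_mul f (witt_mul g k) h) <= lval (witt_mul (witt_mul f g) k h))%E.
Proof.
apply: witt_mul_le => A hA.
set rA := msetmap fst A.
case: (witt_mul_att f g (orbit_sum rA)) => [e|].
  by rewrite [witt_mul f g _]e mul0r lval_le0.
move=> [B [/orbit_sum_neq0[s [bs sB]] e]].
rewrite [witt_mul f g _]e {e}.
pose t := of_nat \o s.
have BE : B = msetmap t rA.
  by rewrite -(msetmapK to_natK B) -sB msetmap_comp.
have bt : bijective t.
  by apply: bij_comp bs; exists to_nat; [exact: of_natK|exact: to_natK].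
have [t' tK t'K] := bt.
pose u (p : nat * nat) := ((t p.1).1, to_nat ((t p.1).2, p.2)).
pose u' (p : nat * nat) := (t' (p.1, (of_nat p.2).1), (of_nat p.2).2).
have bu : bijective u.
  exists u' => -[i j]; rewrite /u /u' /= ?to_natK /=.
    by rewrite -surjective_pairing tK.
  by rewrite t'K /= -surjective_pairing of_natK.
pose v (p : nat * nat) := ((t p.1).2, p.2).
have h1 := @witt_mul_lb R f (witt_mul g k) h (msetmap u A).
apply: (le_trans (h1 _)); first by rewrite symfun_pair.
have h2 := @witt_mul_lb R g k (orbit_sum (msetmap snd (msetmap u A))) (msetmap v A).
rewrite -mulrA; apply: lval_le_mul.
  by rewrite BE /rA !msetmap_comp.
apply: (le_trans (h2 _)).
  by apply/orbit_sum_neq0; rewrite !msetmap_comp; exact: perm_equiv_refl.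
by rewrite BE /rA !msetmap_comp; exact: lexx.
Qed.

Lemma witt_mulA : associative (@witt_mul R).
Proof.
move=> f g k; apply: witt_ext => lam _; apply: lle_anti.
  exact: witt_mulA_le.
rewrite (witt_mulC f g) (witt_mulC _ k) (witt_mulC f) (witt_mulC g k).
exact: witt_mulA_le.
Qed.

Lemma witt_mulr1 f : witt_mul f witt_one = f.
Proof.
apply: witt_ext => lam _; apply: lle_anti.
  case: (hom_att f (msym lam)) => [->|[A [hA ->]]]; first exact: lval_le0.
  pose u (i : nat) := (i, 0).
  have h1 := @witt_mul_lb R f witt_one (msym lam) (msetmap u A).
  apply: (le_trans (h1 _)).
    rewrite msetmap_comp -(perm_equivP (perm_equiv_inj A _))//.
    by move=> i j /= /(can_inj to_natK) [].
  rewrite !msetmap_comp (@eq_msetmap _ _ _ id)// msetmap_id.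
  have -> : msetmap (snd \o u) A = msetn (size A) 0.
    rewrite -(size_msetmap (snd \o u)).
    apply: msetnP1 => j; rewrite /msetmap (perm_mem (perm_eq_seq_mset _)).
    by move=> /mapP[].
  rewrite [witt_one _](@witt_one_eq1 R _ (size A)) ?mulr1//.
  by apply/orbit_sum_neq0; exact: perm_equiv_refl.
apply: witt_mul_le => A hA.
case: (@witt_one_att R (orbit_sum (msetmap snd A))) => [->|].
  by rewrite mulr0 lval_le0.
move=> [-> [n /orbit_sum_neq0[s [[s' sK _] e]]]]; rewrite mulr1.
have AE : msetmap (fun i => (i, s' 0)) (msetmap fst A) = A.
  rewrite msetmap_comp -[RHS]seq_mset_id /msetmap; congr seq_mset.
  rewrite -[RHS]map_id; apply/eq_in_map => -[i j] /(mem_msetmap snd) /= hj.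
  have := mem_msetmap s hj; rewrite e in_msetn => /andP[_ /eqP <-].
  by rewrite sK.
apply: hom_lb; rewrite (perm_equivP (perm_equiv_inj (s := fun i => to_nat (i, s' 0)) _ _)).
  by rewrite -{1}AE msetmap_comp in hA.
by move=> i j /(can_inj to_natK)[].
Qed.

Lemma witt_mul1r f : witt_mul witt_one f = f.
Proof. by rewrite witt_mulC witt_mulr1. Qed.

(* The order of the quantale is the reverse of the usual one. *)
Definition lawvere_le (x y : lawvere R) : Prop := (lval y <= lval x)%E.

Definition witt_le f g : Prop :=
  forall lam, PP lam -> lawvere_le (f (msym lam)) (g (msym lam)).

Lemma witt_le_orbit f g : witt_le f g ->
  forall A, lawvere_le (f (orbit_sum A)) (g (orbit_sum A)).
Proof.
move=> fg A; rewrite orbit_sum_shape.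
have [e|] := eqVneq (parts (shape_part A)) [::]; last exact: fg.
by rewrite /msym e xmon_nil orbit_sum0 !rmorph1 /lawvere_le.
Qed.

Lemma witt_le_mul f f' g g' :
  witt_le f f' -> witt_le g g' -> witt_le (witt_mul f g) (witt_mul f' g').
Proof.
move=> ff' gg' lam _; apply: witt_mul_le => A hA.
apply: (le_trans (witt_mul_lb f' g' hA)); apply: lval_le_mul.
  exact: witt_le_orbit.
exact: witt_le_orbit.
Qed.

(* The product of W(L) on the monomial symmetric functions; [comult] vanishes
   outside a finite set of pairs ([finite_comult]), so the infimum is a minimum. *)
Lemma witt_mul_msym f g lam : PP lam ->
  lval (witt_mul f g (msym lam)) =
  ereal_inf [set (lval (f (msym p.1)) + lval (g (msym p.2)))%E | p in
    [set p : intpart * intpart | [/\ PP p.1, PP p.2 &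
      comult (msym lam) (xmon p.1) (xmon p.2) != 0]]].
Proof.
move=> lam0.
have xmon0 mu : xmon (parts mu) = mset0 -> parts mu = [::].
  by move=> e; rewrite -(shape_xmon mu) e /shape finsupp0.
have PPP (A : {mset nat}) : A != mset0 -> PP (shape_part A).
  move=> A0; apply/negP => /eqP /= e; have := perm_equiv_shape A.
  rewrite e xmon_nil => /size_perm_equiv /esym; rewrite size_mset0.
  by move/eqP; rewrite size_mset_eq0 (negPf A0).
apply: le_anti; apply/andP; split.
  apply: le_ereal_inf_tmp => _ [[mu nu] [/= _ _ /comult_neq0[A [Amu Anu hA]]] <-].
  by rewrite -lvalM /msym -Amu -Anu; exact: witt_mul_lb.
case: (witt_mul_att f g (msym lam)) => [e|[A [hA e]]].
  by rewrite [witt_mul _ _ _]e lval0 leey.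
rewrite [witt_mul _ _ _]e !orbit_sum_shape.
apply: ereal_inf_lbound; exists (shape_part (msetmap fst A), shape_part (msetmap snd A)) => //=.
have A0 : size A != 0.
  move: hA => /orbit_sum_neq0 /size_perm_equiv; rewrite size_msetmap => <-.
  rewrite size_mset_eq0; apply/negP => /eqP /xmon0 l0.
  by move: lam0; rewrite /PP /= l0.
split.
- by apply: PPP; rewrite -size_mset_eq0 size_msetmap.
- by apply: PPP; rewrite -size_mset_eq0 size_msetmap.
rewrite (comult_equiv _ (perm_equiv_shape _) (perm_equiv_shape _)).
by apply/comult_neq0; exists A.
Qed.

End WittLaws.

Record monoidal_poset := MonoidalPoset {
  mp_sort :> Type;
  mp_le : mp_sort -> mp_sort -> Prop;
  mp_mul : mp_sort -> mp_sort -> mp_sort;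
  mp_one : mp_sort;
  mp_le_refl : forall x, mp_le x x;
  mp_le_trans : forall x y z, mp_le x y -> mp_le y z -> mp_le x z;
  mp_le_anti : forall x y, mp_le x y -> mp_le y x -> x = y;
  mp_mulA : associative mp_mul;
  mp_mul1l : left_id mp_one mp_mul;
  mp_mul1r : right_id mp_one mp_mul;
  mp_le_mul : forall x x' y y', mp_le x x' -> mp_le y y' ->
    mp_le (mp_mul x y) (mp_mul x' y') }.

Definition monoidal_functor (P Q : monoidal_poset) (F : P -> Q) : Prop :=
  [/\ forall a b, mp_le a b -> mp_le (F a) (F b),
      forall a b, F (mp_mul a b) = mp_mul (F a) (F b) &
      F (mp_one P) = mp_one Q].

Program Definition lawvere_mp (R : realType) : monoidal_poset :=
  @MonoidalPoset (lawvere R) lawvere_le *%R 1%R _ _ _ _ _ _ _.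
Next Obligation. by move=> R x; rewrite /lawvere_le. Qed.
Next Obligation. by move=> R x y z xy yz; exact: le_trans yz xy. Qed.
Next Obligation. by move=> R x y xy yx; exact: lle_anti. Qed.
Next Obligation. by move=> R; exact: mulrA. Qed.
Next Obligation. by move=> R; exact: mul1r. Qed.
Next Obligation. by move=> R; exact: mulr1. Qed.
Next Obligation. by move=> R x x' y y' xx' yy'; exact: lval_le_mul. Qed.

Program Definition witt_mp (R : realType) : monoidal_poset :=
  @MonoidalPoset (witt R) witt_le witt_mul witt_one _ _ _ _ _ _ _.
Next Obligation. by move=> R f lam _; rewrite /lawvere_le. Qed.
Next Obligation.
by move=> R f g k fg gk lam lam0; exact: le_trans (gk lam lam0) (fg lam lam0).
Qed.
Next Obligation.
move=> R f g fg gf; apply: witt_ext => lam lam0.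
exact: lle_anti (gf lam lam0) (fg lam lam0).
Qed.
Next Obligation. by move=> R; exact: witt_mulA. Qed.
Next Obligation. by move=> R f; exact: witt_mul1r. Qed.
Next Obligation. by move=> R f; exact: witt_mulr1. Qed.
Next Obligation. by move=> R; exact: witt_le_mul. Qed.

(* 0 * +oo never occurs: the part n is positive. *)
Definition theta_spec (R : realType) (theta : lawvere R -> witt R) : Prop :=
  forall (r : lawvere R) (lam : intpart), PP lam ->
    lval (theta r (msym lam)) =
      if parts lam is [:: n] then (n%:R%:E * lval r)%E else +oo%E.

(* Main.v *)
Require Import Defs.
From HB Require Import structures.
From mathcomp Require Import all_boot all_order all_algebra finmap multiset.
From mathcomp Require Import all_classical all_reals ereal.

(** The map theta is a specialization of variables: theta(r) evaluates a
    symmetric function at x_0 = r and x_i = 0 for i > 0, where 0 is the zero of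
    the rig, i.e. +oo in the Lawvere quantale. This makes sense over any
    commutative semiring S and is visibly a rig homomorphism: keep only the
    monomials x_0^n, which gives a polynomial in one variable ([axis_poly]), and
    evaluate it at r ([axis_eval]).

    On the orbit sum of a monomial A this evaluation is r ^+ n if A is a pure
    power x_i^n, and 0 if A involves two variables ([axis_eval_msetn],
    [axis_eval_neq0]). In the Lawvere quantale r ^+ n is the real n * r and 0 is
    +oo, so [axis_eval] satisfies the specification of theta; it is the only map
    that does because the m_lambda generate ([theta_spec_unique]).

    Monotonicity is that of r |-> n * r, and the unit of W(L) is the evaluation
    at (1, 0, 0, ...), which is theta(1). For products, Delta substitutes the
    x_i y_j for the variables, so that applying theta(r) to the x_i and theta(s)
    to the y_j evaluates at (r * s, 0, 0, ...). In terms of monomials, a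
    monomial in the x_i y_j contributes a value other than +oo to the
    minimum only if both its row sums and its column sums are pure powers; then it is itself a power
    (x_i y_j)^n ([msetn_margins]) and contributes r ^+ n * s ^+ n, which is
    (r * s) ^+ n ([axis_evalM]). *)

Set Implicit Arguments.
Unset Strict Implicit.
Unset Printing Implicit Defensive.

Import Order.TTheory GRing.Theory Num.Theory.

Local Open Scope mset_scope.
Local Open Scope ring_scope.

(** Shifting the indices by i is injective and takes x_0^n to x_i^n, and
    [perm_equiv_inj] turns an injective renaming into a permutation. *)
Lemma msetn_perm_equiv (n i j : nat) : perm_equiv (msetn n i) (msetn n j).
Proof.
have axis0 k : perm_equiv (msetn n 0%N) (msetn n k).
  have := @perm_equiv_inj (addn k) (msetn n 0%N) (@addnI k).
  by rewrite msetmap_msetn addn0.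
exact: perm_equiv_trans (perm_equiv_sym (axis0 i)) (axis0 j).
Qed.

Lemma perm_equiv_msetn (A : {mset nat}) (n i : nat) :
  perm_equiv A (msetn n i) -> exists j, A = msetn n j.
Proof.
by move=> /perm_equiv_sym[s [_ <-]]; exists (s i); rewrite msetmap_msetn.
Qed.

Lemma xmon_part1 (n : nat) : xmon [:: n] = msetn n 0%N.
Proof.
apply/msetP => i; rewrite xmonE msetnE; case: i => [|i] //=.
by rewrite nth_nil.
Qed.

(** A partition with at least two parts has a monomial involving both x_0 and
    x_1. *)
Lemma xmon_eq_msetn (lam : intpart) (n i : nat) :
  xmon lam = msetn n i -> (size lam <= 1)%N.
Proof.
have /andP[_ lam0] := partsP lam; move=> e; rewrite leqNgt; apply/negP => sz.
have supp j : (j < 2)%N -> j = i.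
  move=> j2; have : j \in msetn n i.
    rewrite -e -mset_neq0 xmonE; apply: contraNneq lam0 => <-.
    exact/mem_nth/(leq_trans j2).
  by rewrite in_msetn => /andP[_ /eqP].
by have := etrans (supp 0%N isT) (esym (supp 1%N isT)).
Qed.

Lemma msetn_margins (I J : choiceType) (A : {mset I * J}) m n i j :
  msetmap fst A = msetn m i -> msetmap snd A = msetn n j ->
  A = msetn (size A) (i, j).
Proof.
move=> Ai Aj; apply: msetnP1 => -[k l] klA.
have := mem_msetmap fst klA; rewrite Ai in_msetn => /andP[_ /eqP /= ->].
by have := mem_msetmap snd klA; rewrite Aj in_msetn => /andP[_ /eqP /= ->].
Qed.

(** The factors of a pure power of x_i are pure powers of x_i, so on those
    monomials the product of series is the Cauchy product of univariate power
    series. *)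
Lemma series_mul_msetn (c d : series) (n i : nat) :
  series_mul c d (msetn n i) =
  (\sum_(j < n.+1) c (msetn j i) * d (msetn (n - j) i))%N.
Proof.
pose D := [seq msetn j i | j <- iota 0 n.+1].
have injn : injective (fun j : nat => msetn j i).
  by move=> j k /(congr1 (fun A : {mset nat} => A i)); rewrite !msetnxx.
rewrite (@series_mulE _ _ D).
- rewrite big_map -{1}[n.+1]subn0 -/(index_iota _ _) big_mkord.
  apply: eq_bigr => -[j /= jn] _; rewrite big_map.
  rewrite (eq_bigl (fun k => k == n - j)%N); last first.
    move=> k; rewrite -msetnD (inj_eq injn).
    by rewrite -[in LHS](subnKC (n := n) (m := j)) ?eqn_add2l// -ltnS.
  rewrite -big_filter filter_pred1_uniq ?iota_uniq ?big_seq1//.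
  by rewrite mem_iota ltnS leq_subr.
- by rewrite map_inj_uniq ?iota_uniq.
move=> B /msetBDKC e; apply/mapP; exists (size B).
  rewrite mem_iota /= ltnS.
  have := congr1 (fun A : {mset nat} => size A) e.
  by rewrite size_msetD enum_msetn size_nseq => <-; exact: leq_addr.
by have [] := msetn_split (esym e).
Qed.

Section AxisEvaluation.
Context {S : comNzSemiRingType}.
Implicit Types (h k : symfun) (r : S).

Definition deg_bound h : nat := (projT1 (cid (coef_bounded h))).+1.

(** The specialization h(X, 0, 0, ...), with the coefficients of h mapped
    to S. *)
Definition axis_poly h : {poly S} :=
  \poly_(n < deg_bound h) (h (msetn n 0%N))%:R.

(** The truncation in [axis_poly] loses no coefficient, as degrees are bounded. *)
Lemma coef_axis_poly h n : (axis_poly h)`_n = (h (msetn n 0%N))%:R.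
Proof.
rewrite coef_poly; case: ifPn => //; apply: contraNeq.
rewrite /deg_bound; case: cid => d /= hd hn; rewrite ltnS.
have /hd : h (msetn n 0%N) != 0%N by apply: contraNneq hn => ->.
by rewrite enum_msetn size_nseq.
Qed.

Fact axis_poly_0 : axis_poly 0 = 0.
Proof. by apply/polyP => n; rewrite coef_axis_poly coef0. Qed.

Fact axis_poly_D : {morph axis_poly : h k / h + k}.
Proof. by move=> h k; apply/polyP => n; rewrite coefD !coef_axis_poly natrD. Qed.

Fact axis_poly_1 : axis_poly 1 = 1.
Proof.
apply/polyP => n; rewrite coef_axis_poly coef1 /= /series1.
by rewrite -size_mset_eq0 enum_msetn size_nseq.
Qed.

Fact axis_poly_M : {morph axis_poly : h k / h * k}.
Proof.
move=> h k; apply/polyP => n; rewrite coefM coef_axis_poly.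
rewrite -[coef (h * k)]/(series_mul h k) series_mul_msetn.
by rewrite natr_sum; apply: eq_bigr => j _; rewrite natrM !coef_axis_poly.
Qed.

HB.instance Definition _ := GRing.isNmodMorphism.Build symfun {poly S}
  axis_poly (axis_poly_0, axis_poly_D).
HB.instance Definition _ := GRing.isMonoidMorphism.Build symfun {poly S}
  axis_poly (axis_poly_1, axis_poly_M).

(** The value h(r, 0, 0, ...). *)
Definition axis_eval r : {rmorphism symfun -> S} := horner_eval r \o axis_poly.

Lemma axis_eval_msetn r n i : axis_eval r (orbit_sum (msetn n i)) = r ^+ n.
Proof.
suff e : axis_poly (orbit_sum (msetn n i)) = 'X^n.
  by rewrite /axis_eval /= /horner_eval e hornerXn.
apply/polyP => m; rewrite coef_axis_poly coefXn /=; congr (nat_of_bool _)%:R.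
apply/asboolP/eqP => [/size_perm_equiv|->].
  by rewrite !enum_msetn !size_nseq.
exact: msetn_perm_equiv.
Qed.

Lemma axis_eval_neq0 r (A : {mset nat}) :
  axis_eval r (orbit_sum A) != 0 -> exists n i, A = msetn n i.
Proof.
apply: contra_neqP => noA.
suff e : axis_poly (orbit_sum A) = 0.
  by rewrite /axis_eval /= /horner_eval e horner0.
apply/polyP => n; rewrite coef_axis_poly coef0 /= asboolF//.
by move=> /perm_equiv_msetn[i Ai]; apply: noA; exists n, i.
Qed.

End AxisEvaluation.

Section Theta.
Context {R : realType}.
Implicit Types r s : lawvere R.

Lemma lvalX r n : lval (r ^+ n) = (n%:R%:E * lval r)%E.
Proof.
rewrite mule_natl; elim: n => [|n IHn]; first by rewrite expr0 lval1 mule0n.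
by rewrite exprS lvalM IHn muleS.
Qed.

Lemma axis_eval_spec : theta_spec (@axis_eval (lawvere R)).
Proof.
move=> r lam; case lamE: (parts lam) => [|n [|m s]] lam0.
- by rewrite /PP /= lamE in lam0.
- by rewrite /msym lamE xmon_part1 axis_eval_msetn lvalX.
have [e|/axis_eval_neq0[k [i /xmon_eq_msetn]]] :=
  eqVneq (axis_eval r (msym lam)) 0; last by rewrite lamE.
by rewrite e.
Qed.

Lemma axis_evalM r s :
  axis_eval (r * s) = witt_mul (axis_eval r) (axis_eval s).
Proof.
apply: witt_ext => lam _; rewrite /msym; move: (xmon lam) => B.
apply: lle_anti.
  (* Every monomial A in the x_i y_j contributes at least the left-hand side. *)
  apply: witt_mul_le => A /orbit_sum_neq0 BA.
  have [->|] := eqVneq (axis_eval r (orbit_sum (msetmap fst A))) 0.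
    by rewrite mul0r lval_le0.
  move=> /axis_eval_neq0[m [i Ai]].
  have [->|] := eqVneq (axis_eval s (orbit_sum (msetmap snd A))) 0.
    by rewrite mulr0 lval_le0.
  move=> /axis_eval_neq0[n [j Aj]].
  move: BA; rewrite (msetn_margins Ai Aj); move: (size A) => d.
  rewrite !msetmap_msetn => /orbit_sum_equiv ->.
  by rewrite !axis_eval_msetn exprMn.
have [->|/axis_eval_neq0[n [i ->]]] :=
  eqVneq (axis_eval (r * s) (orbit_sum B)) 0; first exact: lval_le0.
(* The bound is attained at the monomial (x_0 y_0)^n. *)
have := @witt_mul_lb R (axis_eval r) (axis_eval s)
  (orbit_sum (msetn n i)) (msetn n (0%N, 0%N)).
rewrite !msetmap_msetn !axis_eval_msetn exprMn; apply.
exact/orbit_sum_neq0/msetn_perm_equiv.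
Qed.

(** Both sides are 0 or +oo on every m_lambda, as n * 0 = 0. *)
Lemma axis_eval1 : axis_eval 1 = @witt_one R.
Proof.
apply: witt_ext => lam lam0; apply: lval_inj.
rewrite axis_eval_spec// witt_one_msym//.
by case: (parts lam) => [//|n [|//]]; rewrite lval1 mule0.
Qed.

Lemma theta_spec_unique (theta theta' : lawvere R -> witt R) :
  theta_spec theta -> theta_spec theta' -> theta = theta'.
Proof.
move=> th th'; apply/funext => r; apply: witt_ext => lam lam0.
by apply: lval_inj; rewrite th// th'.
Qed.

End Theta.

Theorem theorem3p11 (R : realType) :
  (exists! theta : lawvere R -> witt R, theta_spec theta) /\
  (forall theta : lawvere R -> witt R, theta_spec theta ->
     @monoidal_functor (lawvere_mp R) (witt_mp R) theta).
Proof.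
split=> [|theta /theta_spec_unique/(_ axis_eval_spec) ->].
  exists (@axis_eval (lawvere R)); split; first exact: axis_eval_spec.
  by move=> theta; apply: theta_spec_unique; exact: axis_eval_spec.
split=> [r s rs lam lam0|r s|].
- rewrite /lawvere_le !axis_eval_spec//.
  by case: (parts lam) => [//|n [|//]]; exact: lee_wpmul2l.
- exact: axis_evalM.
- exact: axis_eval1.
Qed.
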